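(* Let $\Gamma$ be a finite simplicial graph with vertex set $V$ and let $A_\Gamma$ be the associated right-angled Artin group. The set $\Pi\mathrm{A}_\Gamma$ of palindromic automorphisms of $A_\Gamma$ forms a group (a subgroup of $\mathrm{Aut}(A_\Gamma)$). Moreover, this group splits as a semidirect product $\mathrm{P\Pi A}_\Gamma\rtimes D_\Gamma$.
   Context: $A_\Gamma$ is the group with generating set $V$ and relations $[u,v]=1$ whenever $u,v\in V$ are joined by an edge of $\Gamma$. An automorphism $\alpha\in\mathrm{Aut}(A_\Gamma)$ is palindromic if for each $v\in V$ the element $\alpha(v)$ can be expressed as a palindrome, i.e. a word $u_1\cdots u_k$ on $V^{\pm1}$ identical, as a word, to its reverse $u_k\cdots u_1$. $\Pi\mathrm{A}_\Gamma$ is the set of all palindromic automorphisms. $\mathrm{P\Pi A}_\Gamma$ is the set of pure palindromic automorphisms: those $\alpha$ such that for each $v\in V$, $\alpha(v)$ may be expressed as a palindrome whose middle letter is $v$ or $v^{-1}$; it is a subgroup of $\mathrm{Aut}(A_\Gamma)$. $D_\Gamma$ is the group of diagram automorphisms, i.e. automorphisms of $A_\Gamma$ induced by graph automorphisms of $\Gamma$. *)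

(* Defs.v *)
From HB Require Import structures.
From mathcomp Require Import all_boot perm.
From mathcomp Require Import boolp classical_sets.

Set Implicit Arguments.
Unset Strict Implicit.
Unset Printing Implicit Defensive.

Local Open Scope group_scope.
Local Open Scope classical_set_scope.
Local Open Scope quotient_scope.

(* [(v, false)] stands for the letter v, and [(v, true)] for v^-1. *)
Definition letter (V : Type) : Type := (V * bool)%type.
Definition word (V : Type) : Type := seq (letter V).

Definition linv (V : Type) (x : letter V) : letter V := (x.1, ~~ x.2).

Lemma linvK (V : Type) : involutive (@linv V).
Proof. by case=> v b; rewrite /linv /= negbK. Qed.

Definition palindrome (V : Type) (w : word V) : Prop := w = rev w.

(* Only words of odd length have a middle letter. *)
Definition middle_letter (V : Type) (x : letter V) (w : word V) : Prop :=
  exists s t : word V, size s = size t /\ w = s ++ x :: t.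

Section RAAG.
Variables (V : finType) (adj : rel V).

(* The congruence on words generated by free cancellation and by uv = vu for
   each edge {u, v}; its quotient is the group < V | [u, v] = 1, adj u v >. *)
Inductive raag_eq : word V -> word V -> Prop :=
| raag_eq_refl w : raag_eq w w
| raag_eq_sym w1 w2 : raag_eq w1 w2 -> raag_eq w2 w1
| raag_eq_trans w1 w2 w3 : raag_eq w1 w2 -> raag_eq w2 w3 -> raag_eq w1 w3
| raag_eq_cat w1 w2 w3 w4 :
    raag_eq w1 w2 -> raag_eq w3 w4 -> raag_eq (w1 ++ w3) (w2 ++ w4)
| raag_eq_cancel x : raag_eq [:: x; linv x] [::]
| raag_eq_comm u v :
    adj u v -> raag_eq [:: (u, false); (v, false)] [:: (v, false); (u, false)].

Definition raag_eqb (w1 w2 : word V) : bool := `[< raag_eq w1 w2 >].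

Lemma raag_eqb_equiv : equiv_class_of raag_eqb.
Proof.
split.
- by move=> w; apply/asboolP; apply: raag_eq_refl.
- by move=> w1 w2; apply/idP/idP => /asboolP h; apply/asboolP;
    apply: raag_eq_sym.
- move=> w2 w1 w3 /asboolP h1 /asboolP h2; apply/asboolP.
  exact: raag_eq_trans h1 h2.
Qed.

Canonical raag_equiv := EquivRelPack raag_eqb_equiv.

Definition raag : Type := {eq_quot raag_equiv}.

HB.instance Definition _ := Choice.on raag.
HB.instance Definition _ := EqQuotient.on raag.

(* The element of A_Gamma represented by a word. *)
Definition raag_of_word (w : word V) : raag := \pi w.

Lemma raag_of_wordP w1 w2 :
  raag_of_word w1 = raag_of_word w2 <-> raag_eq w1 w2.
Proof.
split=> [/eqmodP/asboolP //|h].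
by apply/eqmodP/asboolP.
Qed.

Lemma raag_reprK (x : raag) : raag_of_word (repr x) = x.
Proof. exact: reprK. Qed.

Lemma repr_raag_of_word w : raag_eq (repr (raag_of_word w)) w.
Proof. by apply/raag_of_wordP; rewrite raag_reprK. Qed.

Definition winv (w : word V) : word V := rev (map (@linv V) w).

Lemma raag_eq_winvr w : raag_eq (w ++ winv w) [::].
Proof.
elim: w => [|x w IH] /=; first exact: raag_eq_refl.
rewrite /winv /= rev_cons -cats1 catA.
apply: raag_eq_trans (raag_eq_cancel x).
rewrite -[x :: _]/([:: x] ++ _) -[[:: x; linv x]]/([:: x] ++ ([::] ++ [:: linv x])).
apply: raag_eq_cat; first exact: raag_eq_refl.
by apply: raag_eq_cat; [exact: IH | exact: raag_eq_refl].
Qed.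

Lemma winvK : involutive winv.
Proof.
by move=> w; rewrite /winv map_rev revK -map_comp map_id_in // => x _ /=;
  rewrite linvK.
Qed.

Lemma raag_eq_winvl w : raag_eq (winv w ++ w) [::].
Proof. by rewrite -{2}[w]winvK; apply: raag_eq_winvr. Qed.

Definition raag_mul (x y : raag) : raag := raag_of_word (repr x ++ repr y).
Definition raag_one : raag := raag_of_word [::].
Definition raag_inv (x : raag) : raag := raag_of_word (winv (repr x)).

Lemma raag_mulE w1 w2 :
  raag_mul (raag_of_word w1) (raag_of_word w2) = raag_of_word (w1 ++ w2).
Proof. by apply/raag_of_wordP/raag_eq_cat; apply: repr_raag_of_word. Qed.

Lemma raag_mulA : associative raag_mul.
Proof.
move=> x y z; rewrite -[x]raag_reprK -[y]raag_reprK -[z]raag_reprK.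
by rewrite !raag_mulE catA.
Qed.

Lemma raag_mul1 : left_id raag_one raag_mul.
Proof. by move=> x; rewrite -[x]raag_reprK raag_mulE. Qed.

Lemma raag_mulr1 : right_id raag_one raag_mul.
Proof. by move=> x; rewrite -[x]raag_reprK raag_mulE cats0. Qed.

Lemma raag_mulV : left_inverse raag_one raag_inv raag_mul.
Proof.
move=> x; rewrite -{2}[x]raag_reprK raag_mulE.
by apply/raag_of_wordP/raag_eq_winvl.
Qed.

Lemma raag_mulrV : right_inverse raag_one raag_inv raag_mul.
Proof.
move=> x; rewrite -{1}[x]raag_reprK raag_mulE.
by apply/raag_of_wordP/raag_eq_winvr.
Qed.

HB.instance Definition _ := isGroup.Build raag
  raag_mulA raag_mul1 raag_mulr1 raag_mulV raag_mulrV.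

Definition raag_gen (v : V) : raag := raag_of_word [:: (v, false)].

Lemma raag_of_word_cat w1 w2 :
  raag_of_word (w1 ++ w2) = raag_of_word w1 * raag_of_word w2.
Proof. by rewrite -raag_mulE. Qed.

Lemma raag_gen_comm u v : adj u v -> [~ raag_gen u, raag_gen v] = 1.
Proof.
move=> uv; apply/eqP/commgP; rewrite /commute -!raag_of_word_cat.
exact/raag_of_wordP/raag_eq_comm.
Qed.

Lemma raag_letterV v : raag_of_word [:: (v, true)] = (raag_gen v)^-1.
Proof.
apply/esym/mulg1_eq; rewrite -raag_of_word_cat.
exact/raag_of_wordP/raag_eq_cancel.
Qed.

(* Universal property of the presentation. *)
Lemma raag_lift (H : groupType) (f : V -> H) :
  (forall u v, adj u v -> commute (f u) (f v)) ->
  exists phi : raag -> H,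
    {morph phi : x y / x * y} /\ forall v, phi (raag_gen v) = f v.
Proof.
move=> fC.
pose ev (w : word V) : H :=
  foldr (fun x h => (if x.2 then (f x.1)^-1 else f x.1) * h) 1 w.
have evD w1 w2 : ev (w1 ++ w2) = ev w1 * ev w2.
  by elim: w1 => [|x w1 IH] /=; rewrite ?mul1g // IH mulgA.
have evE w1 w2 : raag_eq w1 w2 -> ev w1 = ev w2.
  elim=> {w1 w2} //=.
  - by move=> w1 w2 w3 _ -> _ ->.
  - by move=> w1 w2 w3 w4 _ e1 _ e2; rewrite !evD e1 e2.
  - by case=> v [] /=; rewrite mulg1 ?mulVg ?mulgV.
  - by move=> u v /fC uv; rewrite !mulg1 uv.
exists (fun x => ev (repr x)); split=> [x y|v].
- by rewrite -evD; apply/evE/repr_raag_of_word.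
- by rewrite (evE _ _ (repr_raag_of_word _)) /= mulg1.
Qed.

End RAAG.

Section Automorphisms.
Variable G : groupType.

Record autg : Type := Autg {
  autg_fun :> G -> G;
  autgM : {morph autg_fun : x y / x * y};
  autg_bij : bijective autg_fun }.

HB.instance Definition _ := gen_eqMixin autg.
HB.instance Definition _ := gen_choiceMixin autg.

Lemma autgP (a b : autg) : a =1 b -> a = b.
Proof.
case: a b => [f fM fB] [g gM gB] /= /funext fg; rewrite -{}fg in gM gB *.
by congr Autg; apply: Prop_irrelevance.
Qed.

Definition autg_one : autg :=
  @Autg id (fun _ _ => erefl) (Bijective (fun _ => erefl) (fun _ => erefl)).

Lemma autg_mul_subproof (a b : autg) : {morph a \o b : x y / x * y}.
Proof. by move=> x y /=; rewrite !autgM. Qed.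

Definition autg_mul (a b : autg) : autg :=
  Autg (autg_mul_subproof a b) (bij_comp (autg_bij a) (autg_bij b)).

Lemma autg_inv_exists (a : autg) :
  exists b : autg, cancel a b /\ cancel b a.
Proof.
case: (autg_bij a) => g ag ga.
have gM : {morph g : x y / x * y}.
  by move=> x y; apply: (can_inj ag); rewrite autgM !ga.
by exists (Autg gM (Bijective ga ag)).
Qed.

Definition autg_inv (a : autg) : autg := projT1 (cid (autg_inv_exists a)).

Lemma autgK (a : autg) : cancel a (autg_inv a).
Proof. by rewrite /autg_inv; case: cid => b []. Qed.

Lemma autgVK (a : autg) : cancel (autg_inv a) a.
Proof. by rewrite /autg_inv; case: cid => b []. Qed.

Lemma autg_mulA : associative autg_mul.
Proof. by move=> a b c; apply: autgP. Qed.

Lemma autg_mul1 : left_id autg_one autg_mul.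
Proof. by move=> a; apply: autgP. Qed.

Lemma autg_mulr1 : right_id autg_one autg_mul.
Proof. by move=> a; apply: autgP. Qed.

Lemma autg_mulV : left_inverse autg_one autg_inv autg_mul.
Proof. by move=> a; apply: autgP => x /=; rewrite autgK. Qed.

Lemma autg_mulrV : right_inverse autg_one autg_inv autg_mul.
Proof. by move=> a; apply: autgP => x /=; rewrite autgVK. Qed.

HB.instance Definition _ := isGroup.Build autg
  autg_mulA autg_mul1 autg_mulr1 autg_mulV autg_mulrV.

End Automorphisms.

Definition subgroup (G : groupType) (H : set G) : Prop := group_closed (mem H).

(* K is the internal semidirect product N ><| H. *)
Definition is_sdprod (G : groupType) (N H K : set G) : Prop :=
  [/\ [/\ subgroup N, subgroup H & subgroup K],
      [/\ N `<=` K & H `<=` K],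
      (forall n k, N n -> K k -> N (n ^ k)),
      N `&` H = [set 1] &
      K = [set n * h | n in N & h in H]].

Section Palindromic.
Variables (V : finType) (adj : rel V).

Definition palindromic_aut : set (autg (raag adj)) :=
  [set a : autg (raag adj) | forall v : V, exists w : word V,
     palindrome w /\ a (raag_gen adj v) = raag_of_word adj w].

Definition pure_palindromic_aut : set (autg (raag adj)) :=
  [set a : autg (raag adj) | forall v : V, exists (w : word V) (b : bool),
     [/\ palindrome w, middle_letter (v, b) w &
         a (raag_gen adj v) = raag_of_word adj w]].

Definition diagram_aut : set (autg (raag adj)) :=
  [set a : autg (raag adj) | exists s : {perm V}, (forall u v, adj (s u) (s v) = adj u v) /\
     forall v, a (raag_gen adj v) = raag_gen adj (s v)].

End Palindromic.

Arguments palindromic_aut {V} adj _.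
Arguments pure_palindromic_aut {V} adj _.
Arguments diagram_aut {V} adj _.

(* Main.v *)
Require Import Defs.
From mathcomp Require Import all_boot perm.
From mathcomp Require Import boolp classical_sets.

(** Write [rho] for the anti-automorphism of A_Gamma that reverses words.
    Since v^-1 = v^-1 v v^-1, the elements spelled by a palindrome with middle
    letter v or v^-1 are the p v rho(p), and those spelled by a palindrome of
    even length are the p rho(p).

    An automorphism [a] sending each generator to a palindrome commutes with
    [rho], because [a rho] and [rho a] are anti-homomorphisms that agree on
    generators.  This makes inverses of palindromic automorphisms palindromic
    without solving the word problem: applying [a^-1] to
    a(u) = p v rho(p) gives a^-1(v) = q u rho(q) with q = a^-1(p^-1)
    ([mirror_preimage]).

    The parity of the number of occurrences of a generator is an invariant of
    an element.  It excludes a(u) = p rho(p), which would give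
    u = q rho(q), and it shows that the middle generator of a(u) is an
    injective function of u, so [a] induces a permutation of the vertices
    ([palindromic_induces]).  Such permutations compose as the automorphisms
    do, and the pure automorphisms are those inducing the identity.

    For the splitting, the induced permutation must be a graph automorphism.
    If a and b are distinct and not adjacent, the group maps to the Heisenberg
    group over F_2 with a and b going to the two standard generators and every
    other vertex to 1.  Two elements of the Heisenberg group with the same
    abelianizations as these generators never commute, so elements of the
    shape p a rho(p) and q b rho(q) do not commute either
    ([commute_mirror_adj]). *)

Set Implicit Arguments.
Unset Strict Implicit.
Unset Printing Implicit Defensive.

Local Open Scope group_scope.
Local Open Scope classical_set_scope.

(** * Word invariants and the reversal anti-automorphism *)

Section Words.
Variables (V : finType) (adj : rel V).
Implicit Types (v a b : V) (w : word V) (x y p : raag adj).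

Local Notation gen := (raag_gen adj).
Local Notation elt := (raag_of_word adj).

Lemma raag_elt_ind (P : raag adj -> Prop) :
  P 1 -> (forall v x, P x -> P (gen v * x)) ->
  (forall v x, P x -> P ((gen v)^-1 * x)) -> forall x, P x.
Proof.
move=> P1 Pg Pv x; rewrite -[x]raag_reprK.
elim: (repr x) => [|[v []] w IH]; first exact: P1.
- by rewrite -cat1s raag_of_word_cat raag_letterV; apply: Pv.
- by rewrite -cat1s raag_of_word_cat; apply: Pg.
Qed.

Lemma raag_morph_ext (H : groupType) (f g : raag adj -> H) :
  {morph f : x y / x * y} -> {morph g : x y / x * y} ->
  (forall v, f (gen v) = g (gen v)) -> f =1 g.
Proof.
move=> fM gM fg.
have m1 (h : raag adj -> H) : {morph h : x y / x * y} -> h 1 = 1.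
  by move=> hM; apply: (mulgI (h 1)); rewrite -hM !mulg1.
have mV (h : raag adj -> H) :
    {morph h : x y / x * y} -> forall x, h x^-1 = (h x)^-1.
  by move=> hM x; apply/esym/mulg1_eq; rewrite -hM mulgV m1.
by elim/raag_elt_ind=> [|v x IH|v x IH];
  rewrite ?m1 // fM gM IH ?mV // fg.
Qed.

Lemma raag_eq_rev w1 w2 : raag_eq adj w1 w2 -> raag_eq adj (rev w1) (rev w2).
Proof.
elim=> {w1 w2}.
- by move=> w; apply: raag_eq_refl.
- by move=> w1 w2 _; apply: raag_eq_sym.
- by move=> w1 w2 w3 _ h1 _; apply: raag_eq_trans.
- by move=> w1 w2 w3 w4 _ h1 _ h2; rewrite !rev_cat; apply: raag_eq_cat.
- by move=> x; have := raag_eq_cancel adj (linv x); rewrite linvK.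
- by move=> u v uv; apply/raag_eq_sym/raag_eq_comm.
Qed.

Definition rho x : raag adj := elt (rev (repr x)).

Lemma rho_word w : rho (elt w) = elt (rev w).
Proof. exact/raag_of_wordP/raag_eq_rev/repr_raag_of_word. Qed.

Lemma rho_gen v : rho (gen v) = gen v.
Proof. exact: rho_word. Qed.

Lemma rho1 : rho 1 = 1.
Proof. exact: rho_word. Qed.

Lemma rhoM x y : rho (x * y) = rho y * rho x.
Proof.
rewrite -[x]raag_reprK -[y]raag_reprK -raag_of_word_cat !rho_word.
by rewrite rev_cat raag_of_word_cat.
Qed.

Lemma rhoK : involutive rho.
Proof. by move=> x; rewrite -[x]raag_reprK !rho_word revK. Qed.

Lemma rhoV x : rho x^-1 = (rho x)^-1.
Proof. by apply/esym/mulg1_eq; rewrite -rhoM mulVg rho1. Qed.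

(** Commuting with [rho] is checked on generators by comparing the
    homomorphisms [f] and [x |-> rho (f (rho x))]. *)
Lemma morph_rho (f : raag adj -> raag adj) :
  {morph f : x y / x * y} -> (forall v, rho (f (gen v)) = f (gen v)) ->
  forall x, f (rho x) = rho (f x).
Proof.
move=> fM fr x; have -> : f x = rho (f (rho x)); last by rewrite rhoK.
apply: (raag_morph_ext (g := rho \o f \o rho)) => //= [y z|v].
- by rewrite /= rhoM fM rhoM.
- by rewrite rho_gen fr.
Qed.

Definition wpar a w : bool := odd (count (fun l => l.1 == a) w).

Lemma wpar_cat a w1 w2 : wpar a (w1 ++ w2) = wpar a w1 (+) wpar a w2.
Proof. by rewrite /wpar count_cat oddD. Qed.

Lemma raag_eq_wpar a w1 w2 : raag_eq adj w1 w2 -> wpar a w1 = wpar a w2.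
Proof.
elim=> {w1 w2} //.
- by move=> w1 w2 w3 _ -> _ ->.
- by move=> w1 w2 w3 w4 _ h1 _ h2; rewrite !wpar_cat h1 h2.
- by case=> v c; rewrite /wpar /= addn0 addnn odd_double.
- by move=> u v _; rewrite /wpar /= addnCA.
Qed.

Definition par a x : bool := wpar a (repr x).

Lemma par_word a w : par a (elt w) = wpar a w.
Proof. exact/raag_eq_wpar/repr_raag_of_word. Qed.

Lemma parM a x y : par a (x * y) = par a x (+) par a y.
Proof.
rewrite -[x]raag_reprK -[y]raag_reprK -raag_of_word_cat !par_word.
exact: wpar_cat.
Qed.

Lemma par_gen a v : par a (gen v) = (v == a).
Proof. by rewrite par_word /wpar /= addn0 oddb. Qed.

Lemma par_rho a x : par a (rho x) = par a x.
Proof. by rewrite -[x]raag_reprK rho_word !par_word /wpar count_rev. Qed.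

(** The number mod 2 of pairs formed by an occurrence of [a] and a later
    occurrence of [b]: the central coordinate of the map to the Heisenberg
    group over F_2. *)
Fixpoint heis a b w : bool :=
  if w is l :: w' then ((l.1 == a) && wpar b w') (+) heis a b w' else false.

Lemma heis_cat a b w1 w2 :
  heis a b (w1 ++ w2) =
  heis a b w1 (+) heis a b w2 (+) (wpar a w1 && wpar b w2).
Proof.
elim: w1 => [|l w1 IH] /=; first by rewrite addbF.
rewrite IH wpar_cat /wpar /= oddD oddb.
by do 2![case: (odd _)]; do 2![case: (heis _ _ _)]; case: (_ == a);
  case: (odd _).
Qed.

Lemma raag_eq_heis a b w1 w2 : a != b -> ~~ adj a b -> ~~ adj b a ->
  raag_eq adj w1 w2 -> heis a b w1 = heis a b w2.
Proof.
move=> ab nab nba; elim=> {w1 w2} //.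
- by move=> w1 w2 w3 _ -> _ ->.
- move=> w1 w2 w3 w4 e1 h1 e2 h2.
  by rewrite !heis_cat h1 h2 (raag_eq_wpar _ e1) (raag_eq_wpar _ e2).
- case=> v c; rewrite /= /wpar /= addn0 andbF !addbF oddb.
  by case: eqP => // ->; rewrite (negPf ab).
- move=> u v uv; rewrite /= /wpar /= !addn0 !andbF !addbF !oddb.
  have [ua|_] := eqVneq u a; have [va|_] := eqVneq v a => //=.
  + by rewrite ua va.
  + by case: eqP => // vb; rewrite -ua -vb uv in nab.
  + by case: eqP => // ub; rewrite -va -ub uv in nba.
Qed.

(** The central coordinates of xy and yx differ only in their cross terms, so
    commuting elements have trivial commutator pairing. *)
Lemma commute_par a b x y : a != b -> ~~ adj a b -> ~~ adj b a ->
  commute x y -> par a x && par b y = par a y && par b x.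
Proof.
move=> ab nab nba; rewrite -[x]raag_reprK -[y]raag_reprK /commute.
rewrite -!raag_of_word_cat !par_word => /raag_of_wordP/(raag_eq_heis ab nab nba).
by rewrite !heis_cat; do 2![case: (heis _ _ _)]; do 2![case: (_ && _)].
Qed.

(** * Palindromes as elements p v rho(p) *)

(** The sign of the middle letter is dropped because v^-1 = v^-1 v v^-1. *)
Definition mirror v x : Prop := exists p, x = p * gen v * rho p.

Lemma mirror_gen v : mirror v (gen v).
Proof. by exists 1; rewrite rho1 mul1g mulg1. Qed.

Lemma rho_mirror v x : mirror v x -> rho x = x.
Proof. by case=> p ->; rewrite !rhoM rhoK rho_gen mulgA. Qed.

Lemma par_mirror a v x : mirror v x -> par a x = (v == a).
Proof.
by case=> p ->; rewrite !parM par_rho par_gen addbC addbA addbb.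
Qed.

Lemma mirror_conj v x p : mirror v x -> mirror v (p * x * rho p).
Proof. by case=> q ->; exists (p * q); rewrite rhoM !mulgA. Qed.

Lemma palindrome_cat (s m t : word V) :
  palindrome (s ++ m ++ t) -> size s = size t -> t = rev s.
Proof.
rewrite /palindrome !rev_cat -catA => /eqP e st.
by move: e; rewrite eqseq_cat ?size_rev // => /andP[/eqP-> _]; rewrite revK.
Qed.

Lemma middle_palindrome v c w :
  palindrome w -> middle_letter (v, c) w -> mirror v (elt w).
Proof.
move=> pw [s [t [st def_w]]]; rewrite {}def_w -cat1s in pw *.
have -> : elt (s ++ [:: (v, c)] ++ t) = elt s * elt [:: (v, c)] * rho (elt s).
  by rewrite (palindrome_cat pw st) rho_word -!raag_of_word_cat -catA.
apply: mirror_conj; case: c {pw}; last exact: mirror_gen.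
by exists (gen v)^-1; rewrite raag_letterV rhoV rho_gen mulgK.
Qed.

Lemma mirror_palindrome v x : mirror v x ->
  exists w, [/\ palindrome w, middle_letter (v, false) w & x = elt w].
Proof.
case=> p ->; exists (repr p ++ (v, false) :: rev (repr p)); split.
- by rewrite /palindrome rev_cat rev_cons revK -cats1 -catA.
- by exists (repr p), (rev (repr p)); rewrite size_rev.
- by rewrite -cat1s !raag_of_word_cat raag_reprK -mulgA.
Qed.

Lemma palindrome_cases w : palindrome w ->
  (exists v, mirror v (elt w)) \/ exists p, elt w = p * rho p.
Proof.
move=> pw; set k := (size w)./2.
have szs : size (take k w) = k.
  by rewrite size_takel // -[leqRHS]odd_double_half -addnn addnA leq_addl.
have szd : size (drop k w) = odd (size w) + k.
  by rewrite size_drop -{1}[size w]odd_double_half -addnn addnA addnK.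
have def_w := cat_take_drop k w.
case: (odd _) szd => szd; [left | right].
  case def_d: (drop k w) szd => [|[v c] t] //= [szt]; exists v.
  by apply: (@middle_palindrome v c) => //; exists (take k w), t;
    rewrite szs szt -def_d.
exists (elt (take k w)); rewrite rho_word -raag_of_word_cat.
rewrite -(@palindrome_cat (take k w) [::] (drop k w)) ?def_w //.
by rewrite szs szd.
Qed.

Lemma commute_mirror_adj a b x y : symmetric adj -> a != b ->
  mirror a x -> mirror b y -> commute x y -> adj a b.
Proof.
move=> sym ab mx my xy; apply: contraT => nab.
have nba : ~~ adj b a by rewrite sym.
have := commute_par ab nab nba xy.
by rewrite (par_mirror _ mx) !(par_mirror _ my) (par_mirror _ mx) !eqxx
  eq_sym (negPf ab).
Qed.

End Words.

(** * The permutation induced by a palindromic automorphism *)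

Section Induced.
Variables (V : finType) (adj : rel V).
Implicit Types (a b : autg (raag adj)) (s t : {perm V}) (v : V).

Local Notation gen := (raag_gen adj).

Definition induces a s : Prop := forall v, mirror (s v) (a (gen v)).

Lemma mirror_image a u v x : (forall y, a (rho y) = rho (a y)) ->
  mirror v (a (gen u)) -> mirror u x -> mirror v (a x).
Proof.
by move=> ar mv [p ->]; rewrite !autgM ar; apply: mirror_conj.
Qed.

(** Solve a(u) = p v rho(p) for v, apply a^-1, and use that a^-1 commutes with
    [rho] as well. *)
Lemma mirror_preimage a u v : (forall y, a (rho y) = rho (a y)) ->
  mirror v (a (gen u)) -> mirror u (a^-1 (gen v)).
Proof.
move=> ar [p def_p].
have aK : cancel a a^-1 := autgK a; have aVK : cancel a^-1 a := autgVK a.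
exists (a^-1 p^-1); apply: (can_inj aK).
by rewrite !autgM ar !aVK def_p rhoV !mulgA mulVg mul1g mulgK.
Qed.

Lemma induces_rho a s : induces a s -> forall x, a (rho x) = rho (a x).
Proof.
by move=> ind_a; apply: morph_rho (autgM a) _ => v; apply: rho_mirror (ind_a v).
Qed.

Lemma induces1 : induces 1 1.
Proof. by move=> v; rewrite perm1; apply: mirror_gen. Qed.

(** Products of permutations are read from left to right, those of
    automorphisms from right to left. *)
Lemma inducesM a b s t : induces a s -> induces b t -> induces (a * b) (t * s).
Proof.
move=> ind_a ind_b v; rewrite permM.
exact: mirror_image (induces_rho ind_a) (ind_a (t v)) (ind_b v).
Qed.

Lemma inducesV a s : induces a s -> induces a^-1 s^-1.
Proof.
move=> ind_a v; apply: mirror_preimage (induces_rho ind_a) _.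
by rewrite -{1}[v](permKV s); apply: ind_a.
Qed.

Lemma palindromic_rho a : palindromic_aut adj a ->
  forall x, a (rho x) = rho (a x).
Proof.
move=> pa; apply: morph_rho (autgM a) _ => v; have [w [pw ->]] := pa v.
by rewrite rho_word -pw.
Qed.

(** Two generators u and u' whose images share the middle generator v are both
    recovered as the middle generator of a^-1(v), hence u = u'. *)
Lemma palindromic_induces a : palindromic_aut adj a -> exists s, induces a s.
Proof.
move=> pa; have ar := palindromic_rho pa.
have aK : cancel a a^-1 := autgK a; have aVK : cancel a^-1 a := autgVK a.
have mid v : exists u, mirror u (a (gen v)).
  have [w [pw aw]] := pa v; rewrite aw.
  have [//|[p def_p]] := palindrome_cases adj pw.
  (* A palindrome of even length pulls back to one, but the exponent of v in
     the generator v is odd. *)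
  have : par v (gen v) = par v (a^-1 p * rho (a^-1 p)).
    congr (par v _); apply: (can_inj aK).
    by rewrite autgM ar aVK -def_p.
  by rewrite parM par_rho par_gen eqxx addbb.
have [f mf] := choice mid.
have f_inj : injective f.
  move=> u v fuv; apply/eqP.
  have mu := mirror_preimage ar (mf u); have mv := mirror_preimage ar (mf v).
  by rewrite -(par_mirror v mu) fuv (par_mirror v mv) eqxx.
by exists (perm f_inj) => v; rewrite permE.
Qed.

Lemma palindromicP a : palindromic_aut adj a <-> exists s, induces a s.
Proof.
split=> [|[s ind_a] v]; first exact: palindromic_induces.
by have [w [pw _ aw]] := mirror_palindrome (ind_a v); exists w.
Qed.

Lemma pureP a : pure_palindromic_aut adj a <-> induces a 1.
Proof.
split=> [pa v|ind_a v].
  by rewrite perm1; have [w [c [pw mw ->]]] := pa v; apply: middle_palindrome mw.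
have := ind_a v; rewrite perm1 => /mirror_palindrome[w [pw mw aw]].
by exists w, false.
Qed.

(** One implication suffices, applied to [a] and to its inverse: adjacent
    generators have commuting images. *)
Lemma induces_adj a s : symmetric adj -> irreflexive adj ->
  induces a s -> forall u v, adj (s u) (s v) = adj u v.
Proof.
move=> sym irr.
have impl b t : induces b t -> forall u v, adj u v -> adj (t u) (t v).
  move=> ind_b u v uv; apply: commute_mirror_adj (ind_b u) (ind_b v) _ => //.
    by rewrite (inj_eq perm_inj); apply: contraTneq uv => ->; rewrite irr.
  rewrite /commute -!autgM; congr (b _); apply/commgP/eqP.
  exact: raag_gen_comm.
move=> ind_a u v; apply/idP/idP; last exact: impl.
by move/(impl _ _ (inducesV ind_a)); rewrite !permK.
Qed.

Lemma diagram_induces a s :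
  (forall v, a (gen v) = gen (s v)) -> induces a s.
Proof. by move=> as_ v; rewrite as_; apply: mirror_gen. Qed.

Lemma diagram_aut_exists s : (forall u v, adj (s u) (s v) = adj u v) ->
  exists a, forall v, a (gen v) = gen (s v).
Proof.
have lift t : (forall u v, adj (t u) (t v) = adj u v) ->
    exists f : raag adj -> raag adj,
      {morph f : x y / x * y} /\ forall v, f (gen v) = gen (t v).
  move=> t_adj; apply: raag_lift => u v uv; apply/commgP/eqP.
  by apply: raag_gen_comm; rewrite t_adj.
move=> s_adj; have [f [fM fs]] := lift s s_adj.
have [|g [gM gs]] := lift s^-1.
  by move=> u v; rewrite -s_adj !permKV.
have f_bij : bijective f.
  exists g.
  - apply: (raag_morph_ext (f := g \o f) (g := id)) => //= [y z|v] /=.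
      by rewrite fM gM.
    by rewrite fs gs permK.
  - apply: (raag_morph_ext (f := f \o g) (g := id)) => //= [y z|v] /=.
      by rewrite gM fM.
    by rewrite gs fs permKV.
by exists (Autg fM f_bij).
Qed.

Lemma subgroup_palindromic : subgroup (palindromic_aut adj).
Proof.
split=> [|a b]; rewrite !inE.
  by apply/palindromicP; exists 1; apply: induces1.
move=> /palindromicP[s ind_a] /palindromicP[t ind_b].
by apply/palindromicP; exists (t^-1 * s); apply: inducesM (inducesV _).
Qed.

Lemma subgroup_pure : subgroup (pure_palindromic_aut adj).
Proof.
split=> [|a b]; rewrite !inE; first exact/pureP/induces1.
move=> /pureP ind_a /pureP ind_b; apply/pureP.
by have := inducesM ind_a (inducesV ind_b); rewrite invg1 mulg1.
Qed.

Lemma subgroup_diagram : subgroup (diagram_aut adj).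
Proof.
split=> [|a b]; rewrite !inE.
  by exists 1; split=> [u v|v]; rewrite !perm1.
move=> [s [s_adj as_]] [t [t_adj bt]]; exists (t^-1 * s).
split=> [u v|v]; first by rewrite !permM s_adj -t_adj !permKV.
rewrite permM -as_; congr (a _); apply: (can_inj (autgK b)).
by rewrite bt permKV; apply: (autgVK b).
Qed.

End Induced.

Theorem corollary3p5 (V : finType) (adj : rel V)
    (adj_sym : symmetric adj) (adj_irr : irreflexive adj) :
  subgroup (palindromic_aut adj) /\
  is_sdprod (pure_palindromic_aut adj) (diagram_aut adj) (palindromic_aut adj).
Proof.
have pureW : pure_palindromic_aut adj `<=` palindromic_aut adj.
  by move=> a /pureP ind_a; apply/palindromicP; exists 1.
have diagW : diagram_aut adj `<=` palindromic_aut adj.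
  by move=> a [s [_ as_]]; apply/palindromicP; exists s; apply: diagram_induces.
have palM a b : palindromic_aut adj a -> palindromic_aut adj b ->
    palindromic_aut adj (a * b).
  move=> /palindromicP[s ind_a] /palindromicP[t ind_b].
  by apply/palindromicP; exists (t * s); apply: inducesM.
split; first exact: subgroup_palindromic.
split=> //.
- split; [exact: subgroup_pure | exact: subgroup_diagram |].
  exact: subgroup_palindromic.
- move=> n k /pureP ind_n /palindromicP[s ind_k]; apply/pureP.
  have := inducesM (inducesV ind_k) (inducesM ind_n ind_k).
  by rewrite mulg1 mulgV.
- apply/seteqP; split=> [a [/pureP ind_a [s [_ as_]]]|_ ->] /=; last first.
    split; first exact/pureP/induces1.
    by exists 1; split=> [u v|v]; rewrite !perm1.
  apply: autgP; apply: (raag_morph_ext (autgM a)) => // v; rewrite as_.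
  have := par_mirror v (ind_a v); rewrite perm1 eqxx as_ par_gen.
  by move/eqP->.
- apply/seteqP; split=> [a pa|_ [n pn [h dh <-]]]; last first.
    by apply: palM; [apply: pureW | apply: diagW].
  have [s ind_a] := palindromic_induces pa.
  have s_adj := induces_adj adj_sym adj_irr ind_a.
  have [d ds] := diagram_aut_exists s_adj.
  exists (a * d^-1); last by exists d; [exists s | rewrite mulgVK].
  apply/pureP; have := inducesM ind_a (inducesV (diagram_induces ds)).
  by rewrite mulVg.
Qed.
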